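(* Let $R$ be a p.q.-Baer $*$-ring and suppose there is a vertex $a$ of $\Gamma^*_s(R)$ with $a\neq C(a)$. Then $\Gamma^*_s(R)^c$ is complemented if and only if $R\cong\mathbb{Z}_3\oplus\mathbb{Z}_3$.
   Context: A $*$-ring is a ring $R$ with an involution $x\mapsto x^*$. A projection is an element $e$ with $e^2=e=e^*$; a central projection is a projection in the centre of $R$. For $S\subseteq R$, $r_R(S)=\{x\in R: sx=0\ \forall s\in S\}$. $R$ is a p.q.-Baer $*$-ring if for every $a\in R$, $r_R(aR)=eR$ for some projection $e\in R$. For $a\in R$, the central cover $C(a)$ is the smallest central projection $h$ with $ha=a$ (it exists in a p.q.-Baer $*$-ring). The strong zero-divisor graph $\Gamma^*_s(R)$ is the simple undirected graph with vertex set $\{0\neq a\in R: r_R(aR)\neq\{0\}\}$, in which distinct vertices $a,b$ are adjacent iff $aRb^*=0$. The complement $G^c$ of a simple graph $G$ has the same vertices, distinct vertices adjacent iff not adjacent in $G$. Distinct vertices $a,b$ of a graph $G$ are orthogonal if they are adjacent and have no common neighbour; $G$ is complemented if every vertex has an orthogonal vertex. *)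

(* Defs.v *)
From HB Require Import structures.
From mathcomp Require Import all_boot all_algebra.
From mathcomp Require Import all_classical.

Set Implicit Arguments.
Unset Strict Implicit.
Unset Printing Implicit Defensive.

Import GRing.Theory.
Local Open Scope classical_set_scope.
Local Open Scope ring_scope.

Record involution (R : pzRingType) := Involution {
  star :> R -> R;
  starD : {morph star : x y / x + y};
  starM : forall x y, star (x * y) = star y * star x;
  starK : involutive star
}.

Section StarRing.
Variables (R : pzRingType) (st : involution R).

Definition projection (e : R) : Prop := e * e = e /\ st e = e.

Definition central_projection (h : R) : Prop :=
  projection h /\ forall x : R, h * x = x * h.

Definition rann (S : set R) : set R := [set x | forall s, S s -> s * x = 0].

Definition rmul (a : R) : set R := [set a * x | x in setT].

Definition pq_baer : Prop :=
  forall a : R, exists e : R, projection e /\ rann (rmul a) = rmul e.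

(* The usual order on projections; central projections are compared by it. *)
Definition proj_le (e f : R) : Prop := e * f = e.

(* [is_central_cover a h] reads h = C(a); [central_cover_exists] and
   [central_cover_unique] below make C a function on a p.q.-Baer *-ring. *)
Definition is_central_cover (a h : R) : Prop :=
  [/\ central_projection h, h * a = a &
      forall k, central_projection k -> k * a = a -> proj_le h k].

Lemma star0 : st 0 = 0.
Proof. by apply: (@addrI _ (st 0)); rewrite -starD !addr0. Qed.

Lemma starN x : st (- x) = - st x.
Proof. by apply/eqP; rewrite -addr_eq0 -starD addNr star0. Qed.

Lemma star1 : st 1 = 1.
Proof. by rewrite -[LHS]mul1r -{1}(starK st 1) -starM mul1r starK. Qed.

Lemma central_cover_unique a h k :
  is_central_cover a h -> is_central_cover a k -> h = k.
Proof.
move=> [ch ha minh] [ck ka mink].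
by rewrite -(minh k ck ka) (proj2 ch) (mink h ch ha).
Qed.

Lemma central_cover_exists a : pq_baer -> exists h, is_central_cover a h.
Proof.
move=> /(_ a) [e [[ee se] annE]].
have annP x : (forall r, a * r * x = 0) <-> e * x = x.
  split=> [ax|ex r].
    have : rann (rmul a) x by move=> _ [r _ <-]; apply: ax.
    by rewrite annE => -[y _ <-]; rewrite mulrA ee.
  have : rmul e x by exists x.
  by rewrite -annE; apply; exists r.
have ere x : e * (x * e) = x * e.
  by apply/annP => r; rewrite mulrA -[a * r * x]mulrA; apply: (annP e).2.
have ce x : e * x = x * e.
  have := congr1 st (ere (st x)); rewrite !starM se starK -mulrA => <-.
  exact: ere.
have ea0 : e * a = 0 by rewrite ce -[a in LHS]mulr1; apply: (annP e).2.
exists (1 - e); split.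
- split; first split.
  + by rewrite mulrBl mul1r mulrBr mulr1 ee subrr subr0.
  + by rewrite starD starN star1 se.
  + by move=> x; rewrite mulrBl mulrBr mul1r mulr1 ce.
- by rewrite mulrBl mul1r ea0 subr0.
- move=> k [_ ck] ka.
  have : e * (1 - k) = 1 - k.
    apply/annP => r; rewrite mulrBr mulr1 -[X in _ - X]mulrA -(ck r).
    by rewrite mulrA -(ck a) ka subrr.
  move=> ek; apply/esym/eqP; rewrite -subr_eq0 -{1}[1 - e]mulr1 -mulrBr.
  by rewrite mulrBl mul1r ek subrr.
Qed.

End StarRing.

(* A simple graph whose vertices form a subset of an ambient type. *)
Record sgraph (T : Type) := SGraph {
  vert : set T;
  adj : T -> T -> Prop;
  adj_vert : forall a b, adj a b -> vert a /\ vert b;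
  adj_sym : forall a b, adj a b -> adj b a;
  adj_irrefl : forall a, ~ adj a a
}.

Section Graphs.
Variables (T : Type) (G : sgraph T).

Definition compl_adj (a b : T) : Prop :=
  [/\ vert G a, vert G b, a <> b & ~ adj G a b].

Lemma compl_adj_vert a b : compl_adj a b -> vert G a /\ vert G b.
Proof. by case. Qed.

Lemma compl_adj_sym a b : compl_adj a b -> compl_adj b a.
Proof.
move=> [va vb ab nab]; split=> // [ba|ba]; first by apply: ab.
by apply: nab; apply: adj_sym.
Qed.

Lemma compl_adj_irrefl a : ~ compl_adj a a.
Proof. by case. Qed.

Definition gcompl : sgraph T :=
  SGraph compl_adj_vert compl_adj_sym compl_adj_irrefl.

(* Adjacency already forces a and b to be distinct vertices. *)
Definition orthogonal (a b : T) : Prop :=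
  adj G a b /\ ~ exists c, adj G a c /\ adj G b c.

Definition complemented : Prop :=
  forall a, vert G a -> exists b, orthogonal a b.

End Graphs.

Section StrongZeroDivisorGraph.
Variables (R : pzRingType) (st : involution R).

Definition szd_vert : set R :=
  [set a | a <> 0 /\ rann (rmul a) <> [set 0]].

Definition szd_adj (a b : R) : Prop :=
  [/\ szd_vert a, szd_vert b, a <> b & forall x, a * x * st b = 0].

Lemma szd_adj_vert a b : szd_adj a b -> szd_vert a /\ szd_vert b.
Proof. by case. Qed.

Lemma szd_adj_sym a b : szd_adj a b -> szd_adj b a.
Proof.
move=> [va vb ab H]; split=> // [ba|x]; first by apply: ab.
have := congr1 st (H (st x)).
by rewrite !starM !starK star0 mulrA.
Qed.

Lemma szd_adj_irrefl a : ~ szd_adj a a.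
Proof. by case. Qed.

Definition szd_graph : sgraph R :=
  SGraph szd_adj_vert szd_adj_sym szd_adj_irrefl.

End StrongZeroDivisorGraph.

Definition ring_isomorphic (R S : pzRingType) : Prop :=
  exists f : {rmorphism R -> S}, bijective f.

(* Main.v *)
Require Import Defs.
From HB Require Import structures.
From mathcomp Require Import all_boot all_algebra.
From mathcomp Require Import all_classical.

Set Implicit Arguments.
Unset Strict Implicit.
Unset Printing Implicit Defensive.

Import GRing.Theory.
Local Open Scope ring_scope.

(** In a p.q.-Baer *-ring [a R b^* = 0] holds iff [C(a) C(b) = 0], so the
    complement graph joins [a] and [b] iff [C(a) C(b) <> 0]. If [b] is
    orthogonal to [a <> C(a)] in it, then [C(a) C(b)] and [C(a)] would be common
    neighbours unless [b = C(a)]; hence every nonzero element of [C(a) R] is [a]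
    or [C(a)]. Put [f = 1 - C(a)]. Any nonzero [x] in [f R] has [C(x) = f],
    since otherwise [C(a) + C(x)] would be a common neighbour of [a] and [C(a)];
    an orthogonal of [f] then shows that [f R] has three elements as well.
    Conversely, in [Z_3 + Z_3] the vertex [- a] is orthogonal to [a]. *)

(** * Central projections, central covers and annihilators *)

Section CentralCover.
Variables (R : pzRingType) (st : involution R).
Implicit Types a b e f h k l x y : R.
Hypothesis hR : pq_baer st.
Notation cover := (is_central_cover st).
Notation cproj := (central_projection st).
Notation G := (szd_graph st).

Lemma central_projection_compl h : cproj h -> cproj (1 - h).
Proof.
move=> [[hh sh] ch]; split; first split.
- by rewrite mulrBl mul1r mulrBr mulr1 hh subrr subr0.
- by rewrite starD starN star1 sh.
- by move=> x; rewrite mulrBl mulrBr mul1r mulr1 ch.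
Qed.

Lemma central_projection_mul h k : cproj h -> cproj k -> cproj (h * k).
Proof.
move=> [[hh sh] ch] [[kk sk] ck]; split; first split.
- by rewrite -mulrA [k * _]mulrA -[k * h]ch -mulrA kk mulrA hh.
- by rewrite starM sh sk ch.
- by move=> x; rewrite -mulrA ck mulrA ch mulrA.
Qed.

Lemma central_projection_add h k :
  cproj h -> cproj k -> h * k = 0 -> cproj (h + k).
Proof.
move=> [[hh sh] ch] [[kk sk] ck] hk; split; first split.
- by rewrite mulrDl !mulrDr hh kk -ch hk addr0 add0r.
- by rewrite starD sh sk.
- by move=> x; rewrite mulrDl mulrDr ch ck.
Qed.

(** The right annihilator of the right ideal [a R] is a two-sided ideal, so it contains [x * e] and
    [e * x * e = x * e] for all [x]. Applying the involution to this identity for [st x] gives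
    [e * x * e = e * x], whence [e] is central. *)
Lemma pq_baer_rann_central a :
  exists e, cproj e /\ forall x, (forall r, a * r * x = 0) <-> e * x = x.
Proof.
have [e [[ee se] annE]] := hR a.
have annP x : (forall r, a * r * x = 0) <-> e * x = x.
  split=> [ax|ex r].
    have : rann (rmul a) x by move=> _ [r _ <-]; apply: ax.
    by rewrite annE => -[y _ <-]; rewrite mulrA ee.
  have : rmul e x by exists x.
  by rewrite -annE; apply; exists r.
have ere x : e * (x * e) = x * e.
  by apply/annP => r; rewrite mulrA -[a * r * x]mulrA; apply: (annP e).2.
exists e; split=> //; split=> // x.
have := congr1 st (ere (st x)); rewrite !starM se starK -mulrA => <-.
exact: ere.
Qed.

(** If the central projection [e] generates the annihilator of [a R], then [1 - e] fixes [a], so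
    minimality puts [h] below [1 - e], and [h] kills whatever [e] fixes. *)
Lemma central_cover_annP a h : cover a h ->
  forall x, (forall r, a * r * x = 0) <-> h * x = 0.
Proof.
move=> [[[hh sh] ch] ha minh] x.
have [e [pe annP]] := pq_baer_rann_central a.
split=> [/annP ex|hx r]; last first.
  by rewrite -ha -!mulrA ch -[RHS](mulr0 a) -!mulrA -[x * h]ch hx !mulr0.
have ea : (1 - e) * a = a.
  have := (annP e).2; rewrite pe.1.1 => /(_ erefl 1).
  by rewrite mulr1 -(proj2 pe) mulrBl mul1r => ->; rewrite subr0.
have := minh _ (central_projection_compl pe) ea; rewrite /proj_le => <-.
by rewrite -mulrA mulrBl mul1r ex subrr mulr0.
Qed.

Lemma central_cover_proj h : cproj h -> cover h h.
Proof.
move=> ph; split=> //; first exact: ph.1.1.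
by move=> k pk kh; rewrite /proj_le -(proj2 pk).
Qed.

Lemma central_cover_eq0 a h : cover a h -> (a = 0 <-> h = 0).
Proof.
move=> [ph ha minh]; split=> [a0|h0]; last by rewrite -ha h0 mul0r.
have p0 : cproj 0.
  by split; [split; [rewrite mulr0 | exact: star0] | move=> x; rewrite mulr0 mul0r].
by rewrite -(minh 0 p0) ?mulr0 // a0 mulr0.
Qed.

Lemma szd_vertP a h : cover a h -> (vert G a <-> a <> 0 /\ h <> 1).
Proof.
move=> cah; have annP := central_cover_annP cah; split=> -[a0 ra]; split=> //.
  move=> h1; apply: ra; apply/seteqP; split=> x /=.
    move=> ax; have := (annP x).1; rewrite h1 mul1r; apply=> r.
    by apply: ax; exists r.
  by move=> -> _ [r _ <-]; rewrite mulr0.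
(* The element [1 - h] always annihilates [a R]; a zero annihilator would therefore force
   [h = 1]. *)
move=> rE; apply: ra; apply/eqP; rewrite eq_sym -subr_eq0; apply/eqP.
have : rann (rmul a) (1 - h); last by rewrite rE.
case: cah => [[[hh _] _] _ _].
by move=> _ [r _ <-]; apply: (annP _).2; rewrite mulrBr mulr1 hh subrr.
Qed.

(** From [h * st b = 0] one gets [h * b = 0] by applying the involution; then [1 - h] is a central
    projection fixing [b], and minimality of [k] gives [h * k = 0]. *)
Lemma star_annP a b h k : cover a h -> cover b k ->
  (forall x, a * x * st b = 0) <-> h * k = 0.
Proof.
move=> cah cbk; have [[[hh sh] ch] ha minh] := cah.
have [pk kb mink] := cbk.
rewrite (central_cover_annP cah); split=> hb.
  have hb0 : h * b = 0 by rewrite ch -[LHS](starK st) starM sh hb star0.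
  have /mink : cproj (1 - h) by apply: central_projection_compl; case: cah.
  rewrite mulrBl mul1r hb0 subr0 => /(_ erefl).
  rewrite /proj_le mulrBr mulr1 ch => /eqP.
  by rewrite subr_eq addrC -subr_eq subrr eq_sym => /eqP.
by rewrite -kb starM pk.1.2 -(proj2 pk) mulrA hb mul0r.
Qed.

(** * Adjacency and orthogonality in the complement graph *)

Lemma gcompl_adjP a b h k : cover a h -> cover b k ->
  adj (gcompl G) a b <->
  [/\ vert G a, vert G b, a <> b & h * k <> 0].
Proof.
move=> cah cbk; split=> -[va vb ab nab]; split=> //.
  by move=> hk; apply: nab; split=> //; apply/(star_annP cah cbk).
by move=> [_ _ _ /(star_annP cah cbk)].
Qed.

(** Turns the absence of a common neighbour into a test usable on any candidate [c]: a vertex whose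
    cover meets both [h] and [k] must be one of the two endpoints. *)
Lemma orthogonal_gcomplP a h b k : cover a h -> cover b k ->
  Defs.orthogonal (gcompl G) a b ->
  [/\ b <> 0, k <> 1, a <> b, h * k <> 0 &
   forall c l, cover c l -> c <> 0 -> l <> 1 -> h * l <> 0 -> k * l <> 0 ->
     c = a \/ c = b].
Proof.
move=> cah cbk [/(gcompl_adjP cah cbk) [va vb ab hk] nex].
have [b0 k1] := (szd_vertP cbk).1 vb; split=> // c l ccl c0 l1 hl kl.
have vc : vert G c by apply/(szd_vertP ccl).
apply: contrapT => /not_orP[ca cb]; apply: nex; exists c; split.
  by apply/(gcompl_adjP cah ccl); split=> // e; apply: ca.
by apply/(gcompl_adjP cbk ccl); split=> // e; apply: cb.
Qed.

Lemma central_cover_le h x l : cproj h -> h * x = x -> cover x l -> l * h = l.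
Proof. by move=> ph hx [_ _ minl]; apply: minl. Qed.

Lemma orthogonal_noncover a e b : cover a e -> a <> e -> vert G a ->
  Defs.orthogonal (gcompl G) a b ->
  b = e /\ forall c l, cover c l -> c <> 0 -> l <> 1 -> e * l <> 0 ->
    c = a \/ c = e.
Proof.
move=> cae ae /(szd_vertP cae) [a0 e1] ob.
have [k cbk] := central_cover_exists b hR.
have [b0 k1 ab ek H] := orthogonal_gcomplP cae cbk ob.
have [[pe _ _] [pk _ _]] := (cae, cbk).
have ee := pe.1.1; have kk := pk.1.1.
have pg := central_projection_mul pe pk.
have eg : e * (e * k) = e * k by rewrite mulrA ee.
have kg : k * (e * k) = e * k by rewrite -(proj2 pg) -mulrA kk.
have g1 : e * k <> 1 by move=> g1; apply: e1; rewrite -[e]mulr1 -g1.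
(* First candidate: the product of the two covers. It cannot be [a], because a central projection is
   its own cover, so [b] is a central projection below [e]. *)
have gab : e * k = a \/ e * k = b.
  by apply: H (central_cover_proj pg) _ _ _ _; rewrite ?eg ?kg.
have bg : b = e * k.
  case: gab => // ga; case: ae.
  by apply: (central_cover_unique _ cae); rewrite -ga; apply: central_cover_proj.
have kE : k = e * k.
  by apply: (central_cover_unique cbk); rewrite bg; apply: central_cover_proj.
have e0 : e <> 0 by move=> e0; apply: ek; rewrite e0 mul0r.
(* Second candidate: [e] itself. *)
have be : b = e.
  have [ea'|<- //] : e = a \/ e = b; last by case: ae.
  by apply: H (central_cover_proj pe) _ _ _ _; rewrite ?ee // (proj2 pk).
have ke : k = e by rewrite kE -bg.
split=> // c l ccl c0 l1 el; rewrite -be; apply: H ccl _ _ _ _ => //.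
by rewrite ke.
Qed.

Lemma complemented_corners a e : cover a e -> a <> e -> vert G a ->
  complemented (gcompl G) ->
  (forall x, [\/ e * x = 0, e * x = a | e * x = e]) /\
  exists b, [/\ b <> 0, b <> 1 - e, (1 - e) * b = b &
    forall x, [\/ (1 - e) * x = 0, (1 - e) * x = b | (1 - e) * x = 1 - e]].
Proof.
move=> cae ae va cG.
have [b0 ob0] := cG a va.
have [_ H] := orthogonal_noncover cae ae va ob0.
have [a0 e1] := (szd_vertP cae).1 va.
have [pe ea mine] := cae; have ee := pe.1.1.
have e0 : e <> 0 by move/(central_cover_eq0 cae).
set f := 1 - e; have pf : cproj f := central_projection_compl pe.
have ff : f * f = f := pf.1.1.
have fe : f * e = 0 by rewrite mulrBl mul1r ee subrr.
have ef : e * f = 0 by rewrite (proj2 pe).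
have eDf : e + f = 1 by rewrite addrC subrK.
have f0 : f <> 0 by move=> f0; apply: e1; rewrite -eDf f0 addr0.
have f1 : f <> 1 by move=> f1; apply: e0; rewrite -[e]mul1r -f1.
have na h : cproj h -> h <> a.
  move=> ph ha; case: ae; apply: (central_cover_unique _ cae).
  by rewrite -ha; apply: central_cover_proj.
split=> [x|].
  have [ex0|ex0] := pselect (e * x = 0); first by constructor 1.
  have [l cl] := central_cover_exists (e * x) hR.
  have le : l * e = l by apply: central_cover_le cl; rewrite ?mulrA ?ee.
  have [] := H _ _ cl ex0.
  - by move=> l1; apply: e1; rewrite -[e]mul1r -l1.
  - by rewrite (proj2 pe) le => /(central_cover_eq0 cl).
  - by constructor 2.
  - by constructor 3.
(* The covers [e] and [l] are orthogonal, so [e + l] is a central projection. Were it different from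
   1, it would be a vertex meeting [e], hence [a] or [e]; the former is no central projection and
   the latter means [l = 0]. *)
have coverf x l : x <> 0 -> f * x = x -> cover x l -> l = f.
  move=> x0 fx cl; have lf := central_cover_le pf fx cl.
  have el : e * l = 0 by rewrite -lf (proj2 pe) -mulrA fe mulr0.
  have l0 : l <> 0 by move/(central_cover_eq0 cl).
  have pl : cproj l by case: cl.
  have pm := central_projection_add pe pl el.
  have em : e * (e + l) = e by rewrite mulrDr ee el addr0.
  have [m1|m1] := pselect (e + l = 1).
    by apply: (@addrI _ e); rewrite m1.
  have [] := H _ _ (central_cover_proj pm) _ m1 _; rewrite ?em //.
  - by move=> m0; apply: e0; rewrite -em m0 mulr0.
  - by move/(na _ pm).
  - by move/(congr1 (fun y => y - e)); rewrite addrC addKr subrr => /l0.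
have vf : vert G f by apply/(szd_vertP (central_cover_proj pf)).
(* Complementedness is used a second time, at the vertex [f]; its orthogonal [b] is the third
   element of the corner [f R]. *)
have [b ob] := cG f vf.
have [k cbk] := central_cover_exists b hR.
have [bn0 k1 fb fk H'] := orthogonal_gcomplP (central_cover_proj pf) cbk ob.
have pk : cproj k by case: cbk.
have fkf : f * k = f.
  apply: coverf (central_cover_proj (central_projection_mul pf pk)) => //.
  by rewrite mulrA ff.
(* If [k] met [e], then [b] would be [a] or [e], both with cover [e]; but [f * k = f] while
   [f * e = 0]. *)
have ek : e * k = 0.
  apply: contrapT => ek.
  have ke : k = e.
    have [ba|be] := H _ _ cbk bn0 k1 ek.
      by apply: (central_cover_unique cbk); rewrite ba.
    by apply: (central_cover_unique cbk); rewrite be; apply: central_cover_proj.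
  by apply: f0; rewrite -fkf ke.
have kf : k = f by rewrite -[k]mul1r -eDf mulrDl ek add0r.
exists b; split=> //; first by move=> bf; apply: fb.
  by rewrite -kf; case: cbk.
move=> x; have [fx0|fx0] := pselect (f * x = 0); first by constructor 1.
have [l cl] := central_cover_exists (f * x) hR.
have lf : l = f by apply: coverf cl => //; rewrite mulrA ff.
by have [||||] := H' _ _ cl fx0; rewrite ?lf ?kf ?ff //; [constructor 3|constructor 2].
Qed.

End CentralCover.

(** * Corners with three elements and the isomorphism they yield *)

Section ThreeElementCorner.
Variables (R : pzRingType) (e a : R).
Hypotheses (ee : e * e = e) (ce : forall x, e * x = x * e).
Hypotheses (a0 : a <> 0) (ae : a <> e) (ea : e * a = a) (e0 : e <> 0).
Hypothesis corner3 : forall x, [\/ e * x = 0, e * x = a | e * x = e].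

(** The corner is closed under addition and cancellation excludes [e + e = e]. If [e + e = 0], then
    [e + a] would have to be 0, making both [a] and [e] the opposite of [e]. *)
Lemma corner3_double : e *+ 2 = a.
Proof.
rewrite mulr2n; have := corner3 (e + e); rewrite mulrDr ee; case=> //.
  move=> ee0; have := corner3 (e + a); rewrite mulrDr ee ea; case.
  - by move/eqP; rewrite addr_eq0 => /eqP eNa; case: ae; apply: (@addrI _ e);
    rewrite ee0 eNa addNr.
  - by rewrite -[RHS]add0r => /addIr /e0.
  - by rewrite -[RHS]addr0 => /addrI /a0.
by rewrite -[RHS]addr0 => /addrI /e0.
Qed.

Lemma corner3_triple : e *+ 3 = 0.
Proof.
rewrite mulrS corner3_double.
have := corner3 (e + a); rewrite mulrDr ee ea; case=> //.
  by rewrite -[RHS]add0r => /addIr /e0.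
by rewrite -[RHS]addr0 => /addrI /a0.
Qed.

(** Sums and products in ['Z_3] are natural numbers reduced modulo 3; this removes the reduction
    under [e *+ _]. *)
Lemma corner3_mod n : e *+ (n %% 3) = e *+ n.
Proof. by rewrite {2}(divn_eq n 3) mulrnDr mulnC mulrnA corner3_triple mul0rn add0r. Qed.

Lemma corner3_inj (i j : 'Z_3) : e *+ i = e *+ j -> i = j.
Proof.
have tr := corner3_double.
case: i j => [[|[|[|//]]] ?] [[|[|[|//]]] ?] /=; rewrite ?mulr0n ?mulr1n ?tr => h;
  by [apply: val_inj | case: e0 | case: a0 | case: ae].
Qed.

(** The coordinate of [x] is the [i] with [e * x = e *+ i], obtained by choice; stating it as an
    equivalence also records uniqueness, so later equations on [phi] reduce to equations in the
    corner. *)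
Lemma corner3_coordinate :
  exists phi : R -> 'Z_3, forall x i, phi x = i <-> e * x = e *+ i.
Proof.
have ex x : exists i : 'Z_3, e * x = e *+ i.
  case: (corner3 x) => ->; [exists 0 | exists 2%:R | exists 1] => //.
  by rewrite -corner3_double.
exists (fun x => projT1 (cid (ex x))) => x i.
case: cid => j /= ej; split=> [<- //|ei].
by apply: corner3_inj; rewrite -ej.
Qed.

Lemma corner3_coordinate_morph (phi : R -> 'Z_3) :
  (forall x i, phi x = i <-> e * x = e *+ i) ->
  [/\ forall x y, phi (x - y) = phi x - phi y, phi 1 = 1 &
      forall x y, phi (x * y) = phi x * phi y].
Proof.
move=> phiP; have phiE x : e * x = e *+ phi x by apply/phiP.
have phiD x y : phi (x + y) = phi x + phi y.
  by apply/phiP; rewrite /= corner3_mod mulrDr !phiE mulrnDr.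
split=> [x y||x y].
- by apply: (@addIr _ (phi y)); rewrite -phiD !subrK.
- by apply/phiP; rewrite mulr1.
apply/phiP; rewrite /= corner3_mod.
by rewrite -{1}ee -mulrA [e * (x * y)]mulrA [e * x]ce -mulrA mulrA !phiE
  mulrnAr mulrnAl ee mulrnA.
Qed.

End ThreeElementCorner.

(** Decomposition along [1 = e + f]: the two corner coordinates form a ring morphism, with inverse
    [(i, j)] mapped to [e *+ i + f *+ j]. *)
Lemma corner3_ring_isomorphic (R : pzRingType) (e a b : R) :
  let f := 1 - e in
  e * e = e -> (forall x, e * x = x * e) ->
  a <> 0 -> a <> e -> e * a = a ->
  (forall x, [\/ e * x = 0, e * x = a | e * x = e]) ->
  b <> 0 -> b <> f -> f * b = b ->
  (forall x, [\/ f * x = 0, f * x = b | f * x = f]) ->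
  ring_isomorphic R ('Z_3 * 'Z_3)%type.
Proof.
move=> f ee ce a0 ae ea e3 b0 bf fb f3.
have ff : f * f = f by rewrite mulrBl mul1r mulrBr mulr1 ee subrr subr0.
have cf x : f * x = x * f by rewrite mulrBl mulrBr mul1r mulr1 ce.
have fe : f * e = 0 by rewrite mulrBl mul1r ee subrr.
have ef : e * f = 0 by rewrite ce.
have eDf : e + f = 1 by rewrite addrC subrK.
have e0 : e <> 0 by move=> e0; apply: a0; rewrite -ea e0 mul0r.
have f0 : f <> 0 by move=> f0; apply: b0; rewrite -fb f0 mul0r.
have [phi phiP] := corner3_coordinate ee a0 ae ea e0 e3.
have [psi psiP] := corner3_coordinate ff b0 bf fb f0 f3.
have [phiB phi1 phiM] := corner3_coordinate_morph ee ce a0 ae ea e0 e3 phiP.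
have [psiB psi1 psiM] := corner3_coordinate_morph ff cf b0 bf fb f0 f3 psiP.
pose F x : 'Z_3 * 'Z_3 := (phi x, psi x).
have FB : zmod_morphism F by move=> x y; rewrite /F phiB psiB.
have FM : monoid_morphism F.
  by split=> [|x y]; rewrite /F ?phi1 ?psi1 // phiM psiM.
pose mF := GRing.isZmodMorphism.Build _ _ F FB.
pose mF' := GRing.isMonoidMorphism.Build _ _ F FM.
pose FF : {rmorphism R -> ('Z_3 * 'Z_3)%type} := HB.pack F mF mF'.
exists FF; apply: (@Bijective _ _ _ (fun p : 'Z_3 * 'Z_3 => e *+ p.1 + f *+ p.2)) => [x|[i j]] /=.
  by rewrite -(phiP x _).1 // -(psiP x _).1 // -mulrDl eDf mul1r.
congr pair; [apply/phiP | apply/psiP]; rewrite mulrDr !mulrnAr ?ee ?ff ?ef ?fe.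
  by rewrite mul0rn addr0.
by rewrite mul0rn add0r.
Qed.

(** * The converse, by coordinates in ['Z_3 * 'Z_3] *)

Lemma Z3_mul_eq0 (u v : 'Z_3) : u * v = 0 -> u = 0 \/ v = 0.
Proof.
move=> /(congr1 val).
by case: u v => [[|[|[|//]]] ?] [[|[|[|//]]] ?] //= _;
  [left | left | left | right | right]; apply: val_inj.
Qed.

Lemma Z3_neq0_eq (u v : 'Z_3) : u <> 0 -> v <> 0 -> v = u \/ v = - u.
Proof.
case: u v => [[|[|[|//]]] iu] [[|[|[|//]]] iv] u0 v0;
  first [by case: u0; apply: val_inj | by case: v0; apply: val_inj
        | by left; apply: val_inj | by right; apply: val_inj].
Qed.

Lemma Z3_sqr_mul_eq0 (A B : 'Z_3 * 'Z_3) :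
  A * B = 0 -> (A.1 = 0 \/ B.1 = 0) /\ (A.2 = 0 \/ B.2 = 0).
Proof.
by move=> AB; split; apply: Z3_mul_eq0; [have := congr1 fst AB | have := congr1 snd AB].
Qed.

(** Some coordinate of [E] is nonzero, so [A] and [T] both lie on the other axis, which is a field.
    It serves with [T] the image of [st a], to show [a * st a <> 0]. *)
Lemma Z3_sqr_ann (A T E : 'Z_3 * 'Z_3) :
  A <> 0 -> T <> 0 -> E <> 0 -> A * E = 0 -> T * E = 0 -> A * T <> 0.
Proof.
move: A T E => [a1 a2] [t1 t2] [e1 e2] A0 T0 E0.
move=> /Z3_sqr_mul_eq0 /= [h1 h2] /Z3_sqr_mul_eq0 /= [h3 h4].
move=> /Z3_sqr_mul_eq0 /= [h5 h6].
by case: h1 h2 h3 h4 h5 h6 => ? [] ? [] ? [] ? [] ? [] ?; subst;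
  first [case: A0 | case: T0 | case: E0].
Qed.

(** Each of [A] and [C] lies on one axis, and [E] confines [T] to the axis of [C]. Since
    [A * T <> 0], the axes agree, and an axis has only two nonzero elements. Here [T] stands for the
    image of [st c]. *)
Lemma Z3_sqr_ann_eq (A C T D E : 'Z_3 * 'Z_3) :
  A <> 0 -> C <> 0 -> D <> 0 -> E <> 0 -> A * D = 0 -> C * E = 0 ->
  T * E = 0 -> A * T <> 0 -> C = A \/ C = - A.
Proof.
move: A C T D E => [a1 a2] [c1 c2] [t1 t2] [d1 d2] [e1 e2] A0 C0 D0 E0.
move=> /Z3_sqr_mul_eq0 /= [h1 h2] /Z3_sqr_mul_eq0 /= [h3 h4].
move=> /Z3_sqr_mul_eq0 /= [h5 h6] AT.
have eqP1 (u v : 'Z_3) : (u, 0) <> 0 :> 'Z_3 * 'Z_3 -> (v, 0) <> 0 :> 'Z_3 * 'Z_3 ->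
    (v, 0) = (u, 0) \/ (v, 0) = - (u, 0) :> 'Z_3 * 'Z_3.
  move=> u0 v0; have [||->|->] := @Z3_neq0_eq u v.
  - by move=> u00; apply: u0; rewrite u00.
  - by move=> v00; apply: v0; rewrite v00.
  - by left.
  - by right; congr pair; rewrite oppr0.
have eqP2 (u v : 'Z_3) : (0, u) <> 0 :> 'Z_3 * 'Z_3 -> (0, v) <> 0 :> 'Z_3 * 'Z_3 ->
    (0, v) = (0, u) \/ (0, v) = - (0, u) :> 'Z_3 * 'Z_3.
  move=> u0 v0; have [||->|->] := @Z3_neq0_eq u v.
  - by move=> u00; apply: u0; rewrite u00.
  - by move=> v00; apply: v0; rewrite v00.
  - by left.
  - by right; congr pair; rewrite oppr0.
case: h1 h2 h3 h4 h5 h6 => ? [] ? [] ? [] ? [] ? [] ?; subst;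
  first [by case: A0 | by case: C0 | by case: D0 | by case: E0
        | by apply: eqP1 | by apply: eqP2
        | by case: AT; congr pair; rewrite ?mul0r ?mulr0].
Qed.

Lemma Z3_sqr_complemented (R : pzRingType) (st : involution R) :
  pq_baer st -> ring_isomorphic R ('Z_3 * 'Z_3)%type ->
  complemented (gcompl (szd_graph st)).
Proof.
move=> hR [F bF]; have injF := bij_inj bF.
have F0 x : x <> 0 -> F x <> 0.
  by move=> x0 Fx; apply: x0; apply: injF; rewrite Fx rmorph0.
have mulC (x y : R) : x * y = y * x by apply: injF; rewrite !rmorphM mulrC.
have tripl (x : R) : x *+ 3 = 0.
  apply: injF; rewrite rmorphMn rmorph0 -mulr_natr.
  have -> : 3%:R = 0 :> 'Z_3 * 'Z_3 by congr pair; apply: val_inj.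
  by rewrite mulr0.
have vertE (c : R) : vert (szd_graph st) c ->
    c <> 0 /\ exists E, [/\ E <> 0, F c * E = 0 & F (st c) * E = 0].
  move=> [c0 rc]; split=> //.
  have [e [[ee se] annE]] := hR c.
  have ce : c * e = 0.
    have : rmul e e by exists 1; rewrite ?mulr1.
    by rewrite -annE => /(_ c); apply; exists 1; rewrite ?mulr1.
  exists (F e); split.
  - apply: F0 => e0; apply: rc; rewrite annE e0; apply/seteqP; split=> x /=.
      by move=> [y _ <-]; rewrite mul0r.
    by move=> ->; exists 0; rewrite ?mulr0.
  - by rewrite -rmorphM ce rmorph0.
  (* Because [e] is self-adjoint and [R] is commutative, the annihilator of [c] found above kills
     [st c] too. *)
  - by rewrite -rmorphM -se -starM mulC ce star0 rmorph0.
have st0 (x : R) : x <> 0 -> st x <> 0.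
  by move=> x0 sx; apply: x0; rewrite -(starK st x) sx star0.
move=> a va; have [a0 [D [D0 aD saD]]] := vertE a va.
have vNa : vert (szd_graph st) (- a).
  case: va => _ ra; split=> [/eqP|rE]; first by rewrite oppr_eq0 => /eqP.
  apply: ra; rewrite -rE; apply/seteqP; split=> x ax _ [r _ <-].
    by rewrite !mulNr ax ?oppr0 //; exists r.
  by rewrite -[a]opprK mulNr mulNr (ax (- a * r)) ?oppr0 //; exists r.
(* Otherwise [a + a = 0], and [a *+ 3 = 0] would give [a = 0]. *)
have aNa : a <> - a.
  move=> aNa; apply: a0; rewrite -(tripl a) !mulrS mulr0n addr0.
  by rewrite {3}aNa addNr addr0.
have asa : a * st a <> 0.
  move=> h; apply: (Z3_sqr_ann (F0 _ a0) (F0 _ (st0 _ a0)) D0 aD saD).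
  by rewrite -rmorphM h rmorph0.
exists (- a); split; first split=> //.
  by move=> [_ _ _ /(_ 1)]; rewrite mulr1 starN mulrN => /eqP;
    rewrite oppr_eq0 => /eqP.
move=> [c [[_ vc ac nac] [_ _ nac' _]]].
have [c0 [E [E0 cE scE]]] := vertE c vc.
(* By commutativity, [a * st c = 0] would already make [a] and [c] adjacent in the original
   graph. *)
have aTc : F a * F (st c) <> 0.
  rewrite -rmorphM => h; apply: nac; split=> // x.
  have {}h : a * st c = 0 by apply: injF; rewrite h rmorph0.
  by rewrite -mulrA mulC -mulrA [st c * a]mulC h mulr0.
have [] := Z3_sqr_ann_eq (F0 _ a0) (F0 _ c0) D0 E0 aD cE scE aTc.
  by move/injF => ca; apply: ac.
by rewrite -rmorphN => /injF ca; apply: nac'.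
Qed.

Theorem theorem4p14 (R : pzRingType) (st : involution R)
    (hR : pq_baer st)
    (ha : exists a c : R,
        vert (szd_graph st) a /\ is_central_cover st a c /\ a <> c) :
  complemented (gcompl (szd_graph st)) <->
  ring_isomorphic R ('Z_3 * 'Z_3)%type.
Proof.
split; last exact: Z3_sqr_complemented.
move=> cG; have [a [e [va [cae ae]]]] := ha.
have [e3 [b [b0 bf fb f3]]] := complemented_corners hR cae ae va cG.
have [[[ee _] ce] ea _] := cae.
by apply: corner3_ring_isomorphic ee ce _ ae ea e3 b0 bf fb f3; case: va.
Qed.
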